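(* For a Litherland torus $F\subset\mathbb S^4$ of type $\mathbb Z\oplus\mathbb Z$, i.e. a smoothly embedded oriented torus whose peripheral subgroup satisfies $P_F\cong\mathbb Z\langle\mu\rangle\oplus\mathbb Z\oplus\mathbb Z$ with $\mu$ the meridian, the boundary homomorphism $$i_*:\pi_1(\partial C_F)\cong\mathbb Z^3\longrightarrow\pi_1(C_F)$$ is injective. In particular, no nontrivial primitive boundary slope is null-homotopic in $C_F$.
   Context: $C_F=\mathbb S^4\setminus\operatorname{int}\nu F$, with $\partial C_F\cong\mathbb T^3$. The peripheral subgroup is $P_F=\operatorname{im}(\pi_1(\partial C_F)\to\pi_1(C_F))$; in general $P_F\cong\mathbb Z\langle\mu\rangle\oplus\tau_F$, where $\mu$ is a meridian and $\tau_F$, a quotient of $\pi_1(F)\cong\mathbb Z^2$, is called the type of $F$. Litherland constructed tori with $\tau_F\cong\mathbb Z\oplus\mathbb Z$. A primitive boundary slope is a primitive element of $\pi_1(\partial C_F)\cong\mathbb Z^3$. *)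

(* Defs.v *)
From HB Require Import structures.
From mathcomp Require Import all_boot all_order all_algebra.
From mathcomp Require Import all_classical all_reals all_analysis.
From mathcomp Require Import lra.

Set Implicit Arguments.
Unset Strict Implicit.
Unset Printing Implicit Defensive.
Import Order.TTheory GRing.Theory Num.Theory.
Import numFieldNormedType.Exports.

Local Open Scope classical_set_scope.
Local Open Scope ring_scope.
Local Open Scope quotient_scope.

Section continuity.
Context {R : realType}.

Local Lemma within_comp (T U X : topologicalType) (A : set U) (f : U -> X)
    (g : T -> U) :
  {within A, continuous f} -> continuous g -> (forall t, A (g t)) ->
  continuous (f \o g).
Proof.
move=> /subspace_continuousP cf cg Ag t V /(cf _ (Ag t)) /=.
rewrite /nbhs/= /within/= => nV.
by apply: (@filterS _ (nbhs t) _ _ _ _ (cg t _ nV)) => u /(_ (Ag u)).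
Qed.

Local Lemma within_eq (T X : topologicalType) (A : set T) (f g : T -> X) :
  (forall t, A t -> f t = g t) -> continuous f -> {within A, continuous g}.
Proof.
move=> fg cf; apply: (@subspace_eq_continuous T A X f g).
  by move=> t; rewrite inE => /fg.
exact: continuous_subspaceT.
Qed.

Local Lemma pair_continuous (T U V : topologicalType) (f : T -> U) (g : T -> V) :
  continuous f -> continuous g -> continuous (fun u => (f u, g u)).
Proof.
move=> cf cg t W [[A B] /= [nA nB] ABW].
apply: (@filterS2 _ (nbhs t) _ _ _ _ _ (cf t _ nA) (cg t _ nB)) => u /= Au Bu.
exact: ABW.
Qed.

Local Lemma comp_continuous (T U V : topologicalType) (f : T -> U) (g : U -> V) :
  continuous f -> continuous g -> continuous (g \o f).
Proof. by move=> cf cg t; apply: continuous_comp; [exact: cf|exact: cg]. Qed.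

Local Lemma fst_continuous (T U : topologicalType) : continuous (@fst T U).
Proof. by move=> t; exact: cvg_fst. Qed.

Local Lemma snd_continuous (T U : topologicalType) : continuous (@snd T U).
Proof. by move=> t; exact: cvg_snd. Qed.

Local Lemma id_continuous (T : topologicalType) : continuous (@id T).
Proof. by move=> t; exact: cvg_id. Qed.

Local Lemma sub_continuous (T : topologicalType) (f g : T -> R) :
  continuous f -> continuous g -> continuous (fun t => f t - g t).
Proof. by move=> cf cg t; apply: (@cvgB _ R^o); [exact: cf|exact: cg]. Qed.

Local Lemma add_continuous (T : topologicalType) (f g : T -> R) :
  continuous f -> continuous g -> continuous (fun t => f t + g t).
Proof. by move=> cf cg t; apply: (@cvgD _ R^o); [exact: cf|exact: cg]. Qed.

Local Lemma mul_continuous (T : topologicalType) (f g : T -> R) :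
  continuous f -> continuous g -> continuous (fun t => f t * g t).
Proof. by move=> cf cg t; apply: cvgM; [exact: cf|exact: cg]. Qed.

Local Lemma cst_cts (T U : topologicalType) (c : U) : continuous (fun _ : T => c).
Proof. by move=> t; exact: cvg_cst. Qed.

Local Lemma continuous_glue (T X : topologicalType) (p : T -> R) (c : R)
    (f g : T -> X) :
  continuous p -> continuous f -> continuous g ->
  (forall t, p t = c -> f t = g t) ->
  continuous (fun t => if p t <= c then f t else g t).
Proof.
move=> cp cf cg fg t; rewrite /continuous_at.
have [ptc|ptc|ptc] := ltgtP (p t) c.
- apply: cvg_trans (cf t); apply: near_eq_cvg.
  by apply: (@filterS _ (nbhs t) _ _ _ _ (cp t _ (lt_nbhsl ptc))) => u /= /ltW ->.
- apply: cvg_trans (cg t); apply: near_eq_cvg.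
  have ngt : nbhs (p t) [set u | c < u].
    by apply: open_nbhs_nbhs; split=> //; exact: open_gt.
  apply: (@filterS _ (nbhs t) _ _ _ _ (cp t _ ngt)) => u /= puc.
  by rewrite leNgt puc.
- move=> V nV.
  have nfV := cf t _ nV.
  have ngV : nbhs (g @ t) V by apply: (cg t); rewrite -fg.
  rewrite nbhs_simpl /=.
  apply: (@filterS2 _ (nbhs t) _ _ _ _ _ nfV ngV) => u /= fV gV.
  by case: ifP.
Qed.

Definition clamp (t : R) : R := Num.max 0 (Num.min 1 t).

Lemma clamp_continuous : continuous clamp.
Proof.
move=> t; apply: (@continuous_max R R (cst 0) (fun t => Num.min 1 t)).
  exact: cvg_cst.
by apply: (@continuous_min R R (cst 1) id); [exact: cvg_cst|exact: cvg_id].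
Qed.

Lemma clamp_itv t : (`[0, 1]%classic : set R) (clamp t).
Proof.
rewrite /= in_itv/= /clamp le_max lexx /= ge_max ler01 /= ge_min lexx //.
Qed.

Lemma clamp_id t : 0 <= t <= 1 -> clamp t = t.
Proof. by case/andP=> t0 t1; rewrite /clamp min_r // max_r. Qed.

End continuity.

Local Ltac prove_cts := repeat first
  [ assumption | exact: cst_cts | exact: id_continuous
  | exact: fst_continuous | exact: snd_continuous
  | apply: pair_continuous | apply: sub_continuous | apply: add_continuous
  | apply: mul_continuous
  | match goal with |- continuous (fun p => ?f p.1) =>
      apply: (@comp_continuous _ _ _ fst f) end
  | match goal with |- continuous (fun p => ?f p.2) =>
      apply: (@comp_continuous _ _ _ snd f) end
  ].

Section loops.
Context (R : realType) {X : topologicalType} (x0 : X).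

(* Only the restriction of the function to [0, 1] matters: [loop_homotopic]
   ignores the values outside of [0, 1]. *)
Record loop := Loop {
  loop_fun :> R -> X;
  loop_continuous : {within `[0, 1], continuous loop_fun};
  loop0 : loop_fun 0 = x0;
  loop1 : loop_fun 1 = x0 }.

Definition loop_homotopic (a b : loop) : Prop :=
  exists H : R * R -> X,
  [/\ {within `[0, 1] `*` `[0, 1], continuous H},
      forall t, 0 <= t <= 1 -> H (t, 0) = a t,
      forall t, 0 <= t <= 1 -> H (t, 1) = b t &
      forall s, 0 <= s <= 1 -> H (0, s) = x0 /\ H (1, s) = x0].

Lemma loop_clamp_continuous (a : loop) : continuous (a \o clamp).
Proof.
apply: within_comp (@loop_continuous a) clamp_continuous _ => t.
exact: clamp_itv.
Qed.

Lemma loop_homotopic_reparam (a b c : loop) (r s : R -> R) :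
  continuous r -> continuous s -> r 0 = s 0 -> r 1 = s 1 ->
  (forall t, 0 <= t <= 1 -> 0 <= r t <= 1 /\ b t = a (r t)) ->
  (forall t, 0 <= t <= 1 -> 0 <= s t <= 1 /\ c t = a (s t)) ->
  loop_homotopic b c.
Proof.
move=> cr cs rs0 rs1 rb sc.
exists (fun p => (a \o clamp) ((1 - p.2) * r p.1 + p.2 * s p.1)); split.
- apply: continuous_subspaceT.
  apply: (@comp_continuous _ _ _
    (fun p : R * R => (1 - p.2) * r p.1 + p.2 * s p.1) (a \o clamp));
    last exact: loop_clamp_continuous.
  by prove_cts.
- move=> t t01 /=; rewrite subr0 mul1r mul0r addr0.
  by have [r01 ->] := rb t t01; rewrite clamp_id.
- move=> t t01 /=; rewrite subrr mul1r mul0r add0r.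
  by have [s01 ->] := sc t t01; rewrite clamp_id.
- have i0 : 0 <= (0 : R) <= 1 by rewrite lexx ler01.
  have i1 : 0 <= (1 : R) <= 1 by rewrite lexx ler01.
  move=> u u01 /=; rewrite -rs0 -rs1 -!mulrDl subrK !mul1r.
  have [r0 b0] := rb _ i0; have [r1 b1] := rb _ i1.
  by rewrite !clamp_id // -b0 -b1 loop0 loop1.
Qed.

Lemma loop_homotopic_refl a : loop_homotopic a a.
Proof.
by apply: (@loop_homotopic_reparam a a a id id) => // t; exact: cvg_id.
Qed.

Lemma loop_homotopic_eq (a b : loop) :
  (forall t, 0 <= t <= 1 -> a t = b t) -> loop_homotopic a b.
Proof.
move=> ab; apply: (@loop_homotopic_reparam b a b id id) => //.
- by move=> t; exact: cvg_id.
- by move=> t; exact: cvg_id.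
- by move=> t t01; split=> //; exact: ab.
Qed.

Lemma homotopy_clamp_continuous (H : R * R -> X) :
  {within `[0, 1] `*` `[0, 1], continuous H} ->
  continuous (fun p => H (clamp p.1, clamp p.2)).
Proof.
move=> cH.
apply: (@within_comp _ _ _ _ _ (fun p => (clamp p.1, clamp p.2)) cH).
- by apply: pair_continuous;
    apply: (@comp_continuous _ _ _ _ clamp);
    solve [exact: fst_continuous|exact: snd_continuous|
           exact: clamp_continuous].
- by move=> p; split; exact: clamp_itv.
Qed.

Lemma loop_homotopic_sym a b : loop_homotopic a b -> loop_homotopic b a.
Proof.
case=> H [cH H0 H1 Hx].
exists (fun p => H (clamp p.1, clamp (1 - p.2))); split.
- apply: continuous_subspaceT.
  apply: (@comp_continuous _ _ _ (fun p : R * R => (p.1, 1 - p.2))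
     (fun p => H (clamp p.1, clamp p.2))).
  + by prove_cts.
  + exact: homotopy_clamp_continuous.
- by move=> t t01 /=; rewrite subr0 !clamp_id ?lexx ?ler01 // H1.
- by move=> t t01 /=; rewrite subrr !clamp_id ?lexx ?ler01 // H0.
- move=> s s01 /=; rewrite !(clamp_id (t := 0)) ?(clamp_id (t := 1)) ?lexx ?ler01//.
  by apply: Hx; have := clamp_itv (1 - s); rewrite /= in_itv.
Qed.

Lemma loop_homotopic_trans b a c :
  loop_homotopic a b -> loop_homotopic b c -> loop_homotopic a c.
Proof.
move=> [H [cH H0 H1 Hx]] [K [cK K0 K1 Kx]].
exists (fun p => if p.2 <= 2^-1 then H (clamp p.1, clamp (2 * p.2))
   else K (clamp p.1, clamp (2 * p.2 - 1))); split.
- apply: continuous_subspaceT.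
  apply: (@continuous_glue _ _ _ (@snd R R)).
  + by move=> p; exact: cvg_snd.
  + apply: (@comp_continuous _ _ _ (fun p : R * R => (p.1, 2 * p.2))
     (fun p => H (clamp p.1, clamp p.2))); last exact: homotopy_clamp_continuous.
    by prove_cts.
  + apply: (@comp_continuous _ _ _
      (fun p : R * R => (p.1, 2 * p.2 - 1))
     (fun p => K (clamp p.1, clamp p.2))); last exact: homotopy_clamp_continuous.
    by prove_cts.
  + move=> [t s] /= ->; rewrite divff // subrr.
    rewrite (clamp_id (t := 0)) ?(clamp_id (t := 1)) ?lexx ?ler01//.
    have : 0 <= clamp t <= 1 by have := clamp_itv t; rewrite /= in_itv.
    by move=> t01; rewrite H1 // K0.
- move=> t t01 /=; rewrite invr_ge0 ler0n mulr0 !clamp_id ?lexx ?ler01//.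
  exact: H0.
- move=> t t01 /=; rewrite ifF; last by apply/negbTE; rewrite -ltNge; lra.
  rewrite [2 * 1 - 1](_ : _ = 1); last by lra.
  by rewrite !clamp_id ?lexx ?ler01// K1.
- move=> s s01 /=.
  rewrite !(clamp_id (t := 0)) ?(clamp_id (t := 1)) ?lexx ?ler01//.
  by case: ifP => _; [apply: Hx|apply: Kx];
    have := clamp_itv (2 * s); have := clamp_itv (2 * s - 1);
    rewrite /= !in_itv.
Qed.

HB.instance Definition _ := gen_eqMixin loop.
HB.instance Definition _ := gen_choiceMixin loop.

Definition loop_homotopicb : rel loop := fun a b => `[< loop_homotopic a b >].

Lemma loop_homotopicb_refl : reflexive loop_homotopicb.
Proof. by move=> a; apply/asboolP; exact: loop_homotopic_refl. Qed.

Lemma loop_homotopicb_sym : symmetric loop_homotopicb.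
Proof.
by move=> a b; apply/asboolP/asboolP; exact: loop_homotopic_sym.
Qed.

Lemma loop_homotopicb_trans : transitive loop_homotopicb.
Proof.
move=> b a c /asboolP ab /asboolP bc; apply/asboolP.
exact: loop_homotopic_trans ab bc.
Qed.

Canonical loop_equiv := EquivRel loop_homotopicb
  loop_homotopicb_refl loop_homotopicb_sym loop_homotopicb_trans.

Definition pi1 := {eq_quot loop_homotopicb}.

HB.instance Definition _ := EqQuotient.on pi1.
HB.instance Definition _ := Choice.on pi1.

Definition pi1_class (a : loop) : pi1 := \pi_pi1 a.

Lemma pi1_classP (a b : loop) :
  pi1_class a = pi1_class b <-> loop_homotopic a b.
Proof.
split=> [/eqmodP/asboolP//|ab]; apply/eqmodP/asboolP; exact: ab.
Qed.

Lemma pi1_class_repr (u : pi1) : pi1_class (repr u) = u.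
Proof. exact: reprK. Qed.

Program Definition loop_cst : loop := @Loop (cst x0) _ erefl erefl.
Next Obligation. by apply: continuous_subspaceT => t; exact: cvg_cst. Qed.

Definition cat_fun (a b : R -> X) (t : R) : X :=
  if t <= 2^-1 then a (2 * t) else b (2 * t - 1).

Lemma cat_fun_continuous (a b : loop) :
  {within `[0, 1], continuous (cat_fun a b)}.
Proof.
apply: (@within_eq _ _ _ (cat_fun (a \o clamp) (b \o clamp))).
  move=> t; rewrite /= in_itv /= /cat_fun => t01.
  by case: (leP t 2^-1) => t2 /=; rewrite clamp_id //; lra.
apply: (@continuous_glue _ _ _ id).
- by move=> t; exact: cvg_id.
- move=> t; apply: (@continuous_comp _ _ _ (fun t : R => 2 * t) (a \o clamp)).
    by apply: cvgM; [exact: cvg_cst|exact: cvg_id].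
  exact: loop_clamp_continuous.
- move=> t;
    apply: (@continuous_comp _ _ _ (fun t : R => 2 * t - 1) (b \o clamp)).
    apply: (@cvgB _ R^o); last exact: cvg_cst.
    by apply: cvgM; [exact: cvg_cst|exact: cvg_id].
  exact: loop_clamp_continuous.
- move=> t ->; rewrite divff // subrr /=.
  by rewrite !clamp_id ?lexx ?ler01 // loop0 loop1.
Qed.

Program Definition loop_cat (a b : loop) : loop :=
  @Loop (cat_fun a b) (@cat_fun_continuous a b) _ _.
Next Obligation.
by move=> a b; rewrite /cat_fun invr_ge0 ler0n mulr0 loop0.
Qed.
Next Obligation.
move=> a b; rewrite /cat_fun ifF; last by apply/negbTE; rewrite -ltNge; lra.
by rewrite [2 * 1 - 1](_ : _ = 1) ?loop1 //; lra.
Qed.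

Definition inv_fun (a : R -> X) (t : R) : X := a (1 - t).

Lemma loop_inv_continuous (a : loop) :
  {within `[0, 1], continuous (inv_fun a)}.
Proof.
apply: (@within_eq _ _ _ (inv_fun (a \o clamp))).
  by move=> t; rewrite /= in_itv /= => t01; rewrite /inv_fun /= clamp_id //; lra.
apply: (@comp_continuous _ _ _ (fun t : R => 1 - t) (a \o clamp)).
  by prove_cts.
exact: loop_clamp_continuous.
Qed.

Program Definition loop_inv (a : loop) : loop :=
  @Loop (inv_fun a) (@loop_inv_continuous a) _ _.
Next Obligation. by move=> a; rewrite /inv_fun subr0 loop1. Qed.
Next Obligation. by move=> a; rewrite /inv_fun subrr loop0. Qed.

Lemma loop_cat_homotopic (a a' b b' : loop) :
  loop_homotopic a a' -> loop_homotopic b b' ->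
  loop_homotopic (loop_cat a b) (loop_cat a' b').
Proof.
move=> [H [cH H0 H1 Hx]] [K [cK K0 K1 Kx]].
exists (fun p => if p.1 <= 2^-1 then H (clamp (2 * p.1), clamp p.2)
   else K (clamp (2 * p.1 - 1), clamp p.2)); split.
- apply: continuous_subspaceT.
  apply: (@continuous_glue _ _ _ (@fst R R)).
  + by move=> p; exact: cvg_fst.
  + apply: (@comp_continuous _ _ _ (fun p : R * R => (2 * p.1, p.2))
     (fun p => H (clamp p.1, clamp p.2))); last exact: homotopy_clamp_continuous.
    by prove_cts.
  + apply: (@comp_continuous _ _ _
      (fun p : R * R => (2 * p.1 - 1, p.2))
     (fun p => K (clamp p.1, clamp p.2))); last exact: homotopy_clamp_continuous.
    by prove_cts.
  + move=> [t s] /= ->; rewrite divff // subrr.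
    rewrite (clamp_id (t := 0)) ?(clamp_id (t := 1)) ?lexx ?ler01//.
    have s01 : 0 <= clamp s <= 1 by have := clamp_itv s; rewrite /= in_itv.
    by rewrite (Hx _ s01).2 (Kx _ s01).1.
- move=> t t01 /=; rewrite /cat_fun (clamp_id (t := 0)) ?lexx ?ler01//.
  case: (leP t 2^-1) => t2; rewrite clamp_id; [|lra|move|lra].
  + by rewrite H0 //; lra.
  + by rewrite K0 //; lra.
- move=> t t01 /=; rewrite /cat_fun (clamp_id (t := 1)) ?lexx ?ler01//.
  case: (leP t 2^-1) => t2; rewrite clamp_id; [|lra|move|lra].
  + by rewrite H1 //; lra.
  + by rewrite K1 //; lra.
- move=> s s01 /=.
  rewrite invr_ge0 ler0n mulr0 ifF; last by apply/negbTE; rewrite -ltNge; lra.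
  rewrite [2 * 1 - 1](_ : _ = 1); last by lra.
  rewrite !clamp_id ?lexx ?ler01 //.
  by split; [exact: (Hx _ s01).1|exact: (Kx _ s01).2].
Qed.

Lemma loop_inv_homotopic (a a' : loop) :
  loop_homotopic a a' -> loop_homotopic (loop_inv a) (loop_inv a').
Proof.
move=> [H [cH H0 H1 Hx]].
exists (fun p => H (clamp (1 - p.1), clamp p.2)); split.
- apply: continuous_subspaceT.
  apply: (@comp_continuous _ _ _ (fun p : R * R => (1 - p.1, p.2))
     (fun p => H (clamp p.1, clamp p.2))).
  + by prove_cts.
  + exact: homotopy_clamp_continuous.
- by move=> t t01 /=; rewrite !clamp_id ?lexx ?ler01 // ?H0 //; lra.
- by move=> t t01 /=; rewrite !clamp_id ?lexx ?ler01 // ?H1 //; lra.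
- move=> s s01 /=; rewrite subr0 subrr !clamp_id ?lexx ?ler01//.
  by have [] := Hx _ s01.
Qed.

Local Lemma mulr_cts (c : R) : continuous (fun t : R => c * t).
Proof. by move=> t; apply: cvgM; [exact: cvg_cst|exact: cvg_id]. Qed.

Lemma loop_catA (a b c : loop) :
  loop_homotopic (loop_cat a (loop_cat b c)) (loop_cat (loop_cat a b) c).
Proof.
pose r (t : R) : R := if t <= 2^-1 then
  (if t <= 4^-1 then 2 * t else t + 4^-1) else 2^-1 * t + 2^-1.
apply: (@loop_homotopic_reparam (loop_cat a (loop_cat b c)) _ _ id r) => //.
- by move=> t; exact: cvg_id.
- apply: (@continuous_glue _ _ _ id) => [t|||t ->]; first exact: cvg_id.
  + apply: (@continuous_glue _ _ _ id) => [t|||t ->]; first exact: cvg_id.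
    * exact: mulr_cts.
    * by move=> t; apply: (@cvgD _ R^o); [exact: cvg_id|exact: cvg_cst].
    * by lra.
  + by move=> t; apply: (@cvgD _ R^o); [exact: mulr_cts|exact: cvg_cst].
  + by rewrite ifF; [lra|apply/negbTE; rewrite -ltNge; lra].
- by rewrite /r ifT ?ifT ?mulr0 //; lra.
- by rewrite /r ifF; [lra|apply/negbTE; rewrite -ltNge; lra].
- move=> t t01; rewrite /r /= /cat_fun /= /cat_fun.
  have [t2|t2] := leP t 2^-1.
  + have [t4|t4] := leP t 4^-1.
    * by rewrite !ifT; [split=> //; lra|lra|lra].
    * rewrite ifF; last by apply/negbTE; rewrite -ltNge; lra.
      rewrite ifF; last by apply/negbTE; rewrite -ltNge; lra.
      by rewrite ifT; last lra; split; [lra|congr (b _); lra].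
  + rewrite ifF; last by apply/negbTE; rewrite -ltNge; lra.
    rewrite ifF; last by apply/negbTE; rewrite -ltNge; lra.
    by split; [lra|congr (c _); lra].
Qed.

Lemma loop_cat1l (a : loop) : loop_homotopic (loop_cat loop_cst a) a.
Proof.
apply: (@loop_homotopic_reparam a _ _ (fun t => Num.max 0 (2 * t - 1)) id) => //.
- move=> t; apply: (@continuous_max R R (cst 0) (fun t => 2 * t - 1)).
    exact: cvg_cst.
  by apply: (@cvgB _ R^o); [exact: mulr_cts|exact: cvg_cst].
- by move=> t; exact: cvg_id.
- by rewrite mulr0 sub0r max_l //; lra.
- by rewrite max_r; lra.
- move=> t t01 /=; rewrite /cat_fun; have [t2|t2] := leP t 2^-1.
  + by rewrite max_l ?loop0 ?lexx ?ler01 //; lra.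
  + by rewrite max_r //; [split=> //; lra|lra].
Qed.

Lemma loop_cat1r (a : loop) : loop_homotopic (loop_cat a loop_cst) a.
Proof.
apply: (@loop_homotopic_reparam a _ _ (fun t => Num.min 1 (2 * t)) id) => //.
- move=> t; apply: (@continuous_min R R (cst 1) (fun t => 2 * t)).
    exact: cvg_cst.
  exact: mulr_cts.
- by move=> t; exact: cvg_id.
- by rewrite mulr0 min_r //; lra.
- by rewrite min_l; lra.
- move=> t t01 /=; rewrite /cat_fun; have [t2|t2] := leP t 2^-1.
  + by rewrite min_r //; [split=> //; lra|lra].
  + by rewrite min_l ?loop1 ?lexx ?ler01 //; lra.
Qed.

Local Lemma abs_cts : continuous (fun t : R => `|1 - 2 * t|).
Proof.
move=> t; apply: (@cvg_norm _ R^o).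
by apply: (@cvgB _ R^o); [exact: cvg_cst|exact: mulr_cts].
Qed.

Lemma loop_catV (a : loop) : loop_homotopic (loop_cat (loop_inv a) a) loop_cst.
Proof.
apply: (@loop_homotopic_reparam a _ _ (fun t => `|1 - 2 * t|) (cst 1)).
- exact: abs_cts.
- by move=> t; exact: cvg_cst.
- by rewrite mulr0 subr0 normr1.
- by rewrite ler0_norm /=; lra.
- move=> t t01 /=; rewrite /cat_fun; have [t2|t2] := leP t 2^-1.
  + by rewrite ger0_norm; [split=> //; lra|lra].
  + by rewrite ler0_norm; [split; [lra|congr (a _); lra]|lra].
- by move=> t t01 /=; rewrite loop1 lexx ler01.
Qed.

Lemma loop_catVr (a : loop) : loop_homotopic (loop_cat a (loop_inv a)) loop_cst.
Proof.
apply: (@loop_homotopic_reparam a _ _ (fun t => 1 - `|1 - 2 * t|) (cst 0)).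
- move=> t; apply: (@cvgB _ R^o); first exact: cvg_cst.
  exact: abs_cts.
- by move=> t; exact: cvg_cst.
- by rewrite mulr0 subr0 normr1 subrr.
- by rewrite ler0_norm /=; lra.
- move=> t t01 /=; rewrite /cat_fun; have [t2|t2] := leP t 2^-1.
  + by rewrite ger0_norm; [split; [lra|congr (a _); lra]|lra].
  + by rewrite ler0_norm; [split; [lra|congr (a _); lra]|lra].
- by move=> t t01 /=; rewrite loop0 lexx ler01.
Qed.

Definition pi1_one : pi1 := pi1_class loop_cst.
Definition pi1_mul (u v : pi1) : pi1 := pi1_class (loop_cat (repr u) (repr v)).
Definition pi1_inv (u : pi1) : pi1 := pi1_class (loop_inv (repr u)).

Lemma pi1_mulE a b :
  pi1_mul (pi1_class a) (pi1_class b) = pi1_class (loop_cat a b).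
Proof.
by apply/pi1_classP/loop_cat_homotopic; apply/pi1_classP;
  rewrite pi1_class_repr.
Qed.

Lemma pi1_invE a : pi1_inv (pi1_class a) = pi1_class (loop_inv a).
Proof.
by apply/pi1_classP/loop_inv_homotopic; apply/pi1_classP;
  rewrite pi1_class_repr.
Qed.

Lemma pi1_mulA : associative pi1_mul.
Proof.
move=> u v w.
rewrite -(pi1_class_repr u) -(pi1_class_repr v) -(pi1_class_repr w).
by rewrite !pi1_mulE; apply/pi1_classP; exact: loop_catA.
Qed.

Lemma pi1_mul1g : left_id pi1_one pi1_mul.
Proof.
move=> u; rewrite -(pi1_class_repr u) pi1_mulE.
by apply/pi1_classP; exact: loop_cat1l.
Qed.

Lemma pi1_mulg1 : right_id pi1_one pi1_mul.
Proof.
move=> u; rewrite -(pi1_class_repr u) pi1_mulE.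
by apply/pi1_classP; exact: loop_cat1r.
Qed.

Lemma pi1_mulVg : left_inverse pi1_one pi1_inv pi1_mul.
Proof.
move=> u; rewrite -(pi1_class_repr u) pi1_invE pi1_mulE.
by apply/pi1_classP; exact: loop_catV.
Qed.

Lemma pi1_mulgV : right_inverse pi1_one pi1_inv pi1_mul.
Proof.
move=> u; rewrite -(pi1_class_repr u) pi1_invE pi1_mulE.
by apply/pi1_classP; exact: loop_catVr.
Qed.

HB.instance Definition _ := isGroup.Build pi1
  pi1_mulA pi1_mul1g pi1_mulg1 pi1_mulVg pi1_mulgV.

End loops.

Section pi1_map.
Context {R : realType} {X Y : topologicalType} (f : continuousType X Y)
  (x0 : X).

Program Definition loop_map (a : loop R x0) : loop R (f x0) :=
  @Loop R Y (f x0) (f \o a) _ _ _.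
Next Obligation.
move=> a t; apply: (@continuous_comp (subspace _) _ _ a f).
  exact: loop_continuous.
exact: cts_fun.
Qed.
Next Obligation. by move=> a /=; rewrite loop0. Qed.
Next Obligation. by move=> a /=; rewrite loop1. Qed.

Definition pi1_map (u : pi1 R x0) : pi1 R (f x0) :=
  pi1_class (loop_map (repr u)).

Lemma loop_map_homotopic a b :
  loop_homotopic a b -> loop_homotopic (loop_map a) (loop_map b).
Proof.
move=> [H [cH H0 H1 Hx]]; exists (f \o H); split=> [p|t t01|t t01|s s01] /=.
- apply: (@continuous_comp (subspace _) _ _ H f); first exact: cH.
  exact: cts_fun.
- by rewrite H0.
- by rewrite H1.
- by have [-> ->] := Hx _ s01.
Qed.

Lemma pi1_mapE a : pi1_map (pi1_class a) = pi1_class (loop_map a).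
Proof.
by apply/pi1_classP/loop_map_homotopic/pi1_classP; rewrite pi1_class_repr.
Qed.

Lemma pi1_mapM : {morph pi1_map : u v / (u * v)%g}.
Proof.
move=> u v; rewrite -(pi1_class_repr u) -(pi1_class_repr v).
rewrite [(_ * _)%g]pi1_mulE !pi1_mapE [RHS]pi1_mulE.
apply/pi1_classP/loop_homotopic_eq => t t01 /=.
by rewrite /cat_fun; case: ifP.
Qed.

HB.instance Definition _ := isMultiplicative.Build _ _ pi1_map pi1_mapM.

End pi1_map.
Arguments pi1_map {R X Y} f x0 u.

Definition null_homotopic (R : realType) (X : topologicalType) (x0 : X)
    (a : loop R x0) : Prop :=
  loop_homotopic a (loop_cst R x0).

Definition iso_onto (A : zmodType) (G : groupType) (h : A -> G) (P : set G)
    : Prop :=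
  [/\ {morph h : u v / u + v >-> (u * v)%g}, injective h & range h = P].

(* An element that is not a proper power; taking [n = 0] shows that the unit is
   not primitive, and negative exponents are covered by replacing [h] with its
   inverse. *)
Definition primitive (G : groupType) (g : G) : Prop :=
  forall (h : G) (n : nat), g = (h ^+ n)%g -> n = 1%N.

Section smooth.
Context {R : realType}.

Fixpoint Ck_on (V W : normedModType R) (k : nat) (U : set V) (f : V -> W)
    : Prop :=
  if k is k'.+1 then
    (forall x, U x -> differentiable f x) /\
    (forall v, Ck_on k' U (fun x => 'D_v f x))
  else forall x, U x -> {for x, continuous f}.

(* [A] need not be open: smoothness on [A] is smoothness on some open
   neighbourhood of [A]. *)
Definition smooth_on (V W : normedModType R) (A : set V) (f : V -> W) : Prop :=
  exists U : set V, [/\ open U, A `<=` U & forall k, Ck_on k U f].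

Definition sqnorm n (x : 'rV[R]_n) : R := \sum_i (x 0 i) ^+ 2.

Definition sphere4 : set 'rV[R]_5 := [set x | sqnorm x = 1].
Definition disk : set 'rV[R]_2 := [set v | sqnorm v <= 1].
Definition open_disk : set 'rV[R]_2 := [set v | sqnorm v < 1].
Definition circle : set 'rV[R]_2 := [set v | sqnorm v = 1].

(* Equality of the classes of [x] and [y] in the torus R^2 / Z^2. *)
Definition torus_eq (x y : 'rV[R]_2) : Prop :=
  forall i, x 0 i - y 0 i \is a Num.int.

End smooth.

(* A smooth embedding of R^2 / Z^2 in the unit sphere of R^5, as a
   Z^2-periodic map on R^2. The torus is oriented by its parametrization. *)
Record smooth_torus (R : realType) := SmoothTorus {
  torus_map :> 'rV[R]_2 -> 'rV[R]_5;
  torus_smooth : smooth_on setT torus_map;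
  torus_sphere : forall x, sphere4 (torus_map x);
  torus_inj : forall x y, torus_map x = torus_map y <-> torus_eq x y;
  torus_immersion : forall x, injective ('d torus_map x) }.

(* A closed tubular neighbourhood of the torus, as a smooth embedding of
   (R^2 / Z^2) x D^2. The disk bundle is a product because the normal bundle of
   a closed oriented surface in the 4-sphere is trivial. *)
Record tubular (R : realType) (F : smooth_torus R) := Tubular {
  tub_map :> 'rV[R]_2 * 'rV[R]_2 -> 'rV[R]_5;
  tub_smooth : smooth_on (setT `*` disk) tub_map;
  tub_sphere : forall x v, disk v -> sphere4 (tub_map (x, v));
  tub_inj : forall x y v w, disk v -> disk w ->
    tub_map (x, v) = tub_map (y, w) <-> torus_eq x y /\ v = w;
  tub_immersion : forall x v, disk v -> injective ('d tub_map (x, v));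
  tub_zero : forall x, tub_map (x, 0) = F x }.

Section exterior.
Context {R : realType} {F : smooth_torus R} (nu : tubular F).

Definition exterior : set 'rV[R]_5 :=
  sphere4 `\` nu @` (setT `*` open_disk).

Definition boundary : set 'rV[R]_5 := nu @` (setT `*` circle).

Lemma boundary_exterior : boundary `<=` exterior.
Proof.
move=> _ [[x v] [_ /= v1] <-].
have dv : disk v by rewrite /disk /= v1.
split; first exact: tub_sphere.
move=> [[y w] [_ /= w1]] yw.
have dw : disk w by exact: ltW.
have [_ wv] := (tub_inj nu y x dw dv).1 yw.
by move: w1; rewrite /open_disk /= wv v1 ltxx.
Qed.

Definition boundary_incl : set_type boundary -> set_type exterior :=
  fun p => SigSub (mem_set (boundary_exterior (set_valP p))).

Lemma boundary_incl_continuous : continuous boundary_incl.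
Proof.
apply/(@continuous_comp_initial _ _ _ set_val boundary_incl) => p.
exact: (@initial_continuous (set_type boundary) _ set_val).
Qed.

HB.instance Definition _ := isContinuous.Build _ _ boundary_incl
  boundary_incl_continuous.

Definition circle_point (a : R) : 'rV[R]_2 :=
  \row_i (if i == 0 then cos (2 * pi * a) else sin (2 * pi * a)).

Lemma circle_pointP a : circle (circle_point a).
Proof.
by rewrite /circle /sqnorm /= big_ord_recl big_ord1 !mxE /= cos2Dsin2.
Qed.

Lemma circle_pointD1 a : circle_point (a + 1) = circle_point a.
Proof.
apply/rowP => i; rewrite !mxE mulrDr mulr1 mulr_natl.
by rewrite cosD2pi sinD2pi.
Qed.

Lemma circle_point_continuous : continuous circle_point.
Proof.
have c2 : continuous (fun a : R => 2 * pi * a).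
  by apply: mul_continuous; prove_cts.
have cc : continuous (fun a : R => cos (2 * pi * a)).
  by apply: (comp_continuous c2); exact: continuous_cos.
have cs : continuous (fun a : R => sin (2 * pi * a)).
  by apply: (comp_continuous c2); exact: continuous_sin.
move=> a V [P nP PV].
have := nP 0 0; rewrite mxE /= => n0; have := nP 0 1; rewrite mxE /= => n1.
apply: (@filterS2 _ (nbhs a) _ _ _ _ _ (cc a _ n0) (cs a _ n1)) => b /= b0 b1.
apply: PV => i j; rewrite (ord1 i) mxE.
by case: j => -[|[|//]] jlt /=; [move: b0|move: b1]; congr (P _ _ _);
  apply: val_inj.
Qed.

Lemma boundary_pointP x a : boundary (nu (x, circle_point a)).
Proof.
by exists (x, circle_point a) => //; split=> //; exact: circle_pointP.
Qed.

Definition boundary_point (x : 'rV[R]_2) (a : R) : set_type boundary :=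
  SigSub (mem_set (boundary_pointP x a)).

Definition meridian_fun x a (t : R) : set_type boundary :=
  boundary_point x (a + t).

Lemma meridian_fun_continuous x a :
  {within `[0, 1], continuous (meridian_fun x a)}.
Proof.
apply: continuous_subspaceT.
apply: (@continuous_comp_initial _ _ _ set_val (meridian_fun x a)) => t.
have cp : continuous (fun t : R => (x, circle_point (a + t))).
  apply: pair_continuous; first exact: cst_cts.
  apply: (@comp_continuous _ _ _ (fun t : R => a + t) circle_point).
    by prove_cts.
  exact: circle_point_continuous.
have [U [_ AU /(_ 0%N) /= cU]] := tub_smooth nu.
apply: (@continuous_comp _ _ _ (fun t : R => (x, circle_point (a + t))) nu).
  exact: cp.
apply: cU; apply: AU; split=> //=.
by have := circle_pointP (a + t); rewrite /circle /disk /= => ->.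
Qed.

(* The circle bounding the normal disk at [F x], run through once from
   [circle_point a]. *)
Program Definition meridian x a : loop R (boundary_point x a) :=
  @Loop R _ _ (meridian_fun x a) (@meridian_fun_continuous x a) _ _.
Next Obligation. by move=> x a; rewrite /meridian_fun addr0. Qed.
Next Obligation.
by move=> x a; apply: val_inj; rewrite /= circle_pointD1.
Qed.

(* The points [nu (x, circle_point a)] are all the points of the boundary, so
   the base point below is arbitrary. *)
Definition boundary_hom x a :
    {multiplicative pi1 R (boundary_point x a) ->
                    pi1 R (boundary_incl (boundary_point x a))} :=
  pi1_map boundary_incl (boundary_point x a).

Definition peripheral x a : set (pi1 R (boundary_incl (boundary_point x a))) :=
  range (boundary_hom x a).

(* [tau] is the type of [F]: the peripheral subgroup is isomorphic to
   Z mu (+) tau. *)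
Definition has_type x a (tau : zmodType) : Prop :=
  exists2 h : int * tau -> pi1 R (boundary_incl (boundary_point x a)),
    iso_onto h (@peripheral x a) &
    h (1, 0) = boundary_hom x a (pi1_class (meridian x a)).

End exterior.
Arguments boundary_incl {R F} nu p.

(* Main.v *)
Require Import Defs.
From mathcomp Require Import all_boot all_order all_algebra.
From mathcomp Require Import all_classical all_reals all_analysis.
From mathcomp Require Import ring lra.

Set Implicit Arguments.
Unset Strict Implicit.
Unset Printing Implicit Defensive.
Import Order.TTheory GRing.Theory Num.Theory.
Import numFieldNormedType.Exports.

Local Open Scope classical_set_scope.
Local Open Scope ring_scope.

(* The boundary is a quotient of R^3 by Z^3, hence its fundamental group is Z^3:
   loops and homotopies lift to R^3, and the class of a loop is determined by
   the displacement of its lift. If the type is Z (+) Z, the peripheral subgroup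
   is also isomorphic to Z^3, so that the boundary homomorphism induces a
   surjective endomorphism of Z^3. Such an endomorphism is injective, since a
   one-sided inverse of a square matrix over Z is two-sided.

   Maps from the square to the circle are lifted by a closed formula: by
   compactness, for n large enough f ((k + 1) p / n) and f (k p / n) always lie
   in a common open half-circle, so that adding the arctangents of the successive
   differences of argument along the segment from 0 to p gives an argument of
   f p depending continuously on p. *)

(** * Continuity of row vectors, uniformity from compactness, integer-valued functions *)

Section continuity.
Context {R : realType}.

Lemma cvg_row (T : Type) (B : set_system T) (n : nat) (f : T -> 'rV[R]_n)
    (l : 'rV[R]_n) :
  Filter B -> (forall i, f t 0 i @[t --> B] --> l 0 i) -> f @ B --> l.
Proof.
move=> FB cf V [P nP PV].
have PB i : \forall t \near B, P 0 i (f t 0 i) by apply: cf; exact: nP.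
rewrite nbhs_simpl /=; apply: filterS (filter_forall _ PB) => t Pt.
by apply: PV => i j; rewrite ord1.
Qed.

Lemma continuous_row (T : topologicalType) (n : nat) (f : T -> 'rV[R]_n) :
  (forall i, continuous (fun t => f t 0 i)) -> continuous f.
Proof. by move=> cf t; apply: cvg_row => i; exact: cf. Qed.

Lemma continuous_sum (T : topologicalType) (I : Type) (r : seq I)
    (f : I -> T -> R) :
  (forall i, continuous (f i)) -> continuous (fun t => \sum_(i <- r) f i t).
Proof.
move=> cf; elim: r => [|i r IH] t.
  under eq_fun do rewrite big_nil.
  exact: cvg_cst.
under eq_fun do rewrite big_cons.
by apply: (@cvgD _ R^o); [exact: cf|exact: IH].
Qed.

(** Positivity of [F] spreads from [K] times 0 to a neighbourhood of each of its points, and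
    compactness of [K] makes the range of admissible second coordinates uniform. This supplies the
    number of subdivision steps for lifting to the line. *)
Lemma compact_pos_invn (T : topologicalType) (K : set T) (F : T * R -> R) :
  compact K -> continuous F -> (forall x, K x -> 0 < F (x, 0)) ->
  exists n : nat, forall x, K x -> 0 < F (x, n.+1%:R^-1).
Proof.
move=> /compact_near_coveringP cK cF F0.
have nF x : K x -> \forall x' \near x & d \near (0 : R), 0 < F (x', d).
  move=> Kx; have nF0 : nbhs (F (x, 0)) [set r | 0 < r].
    by apply: open_nbhs_nbhs; split; [exact: open_gt|exact: F0].
  have [[A B] /= [nA nB] AB] := cF (x, 0) _ nF0.
  by exists (A, B) => // -[y d] [] /= Ay Bd; exact: (AB (y, d)).
have nK : nbhs (0 : R) [set d | forall x, K x -> 0 < F (x, d)].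
  exact: (cK _ (nbhs (0 : R)) (fun d x => 0 < F (x, d)) _ nF).
have /nbhs_ballP[e /= e0 eF] := nK.
have [n _ nle] := near_infty_natSinv_lt (PosNum e0).
exists n => x Kx; apply: (eF n.+1%:R^-1) => //.
rewrite /ball /= sub0r normrN ger0_norm ?invr_ge0 ?ler0n //.
by apply: (nle n); rewrite /= leqnn.
Qed.

(** If the end values differed, they would differ by at least 1, and the intermediate value theorem
    would produce a value half a unit above an integer. The decreasing case follows by negation. *)
Lemma int_valued_const (f : R -> R) :
  {within `[0, 1], continuous f} -> (forall t, 0 <= t <= 1 -> f t \is a Num.int) ->
  f 1 = f 0.
Proof.
have main (g : R -> R) : {within `[0, 1], continuous g} ->
    (forall t, 0 <= t <= 1 -> g t \is a Num.int) -> ~ (g 0 < g 1).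
  move=> cg gZ g01.
  have Z0 : g 0 \is a Num.int by apply: gZ; rewrite lexx ler01.
  have Z1 : g 1 \is a Num.int by apply: gZ; rewrite lexx ler01.
  have : 1 <= `|g 1 - g 0|.
    by apply: norm_intr_ge1; [exact: rpredB|rewrite subr_eq0 gt_eqF].
  rewrite gtr0_norm ?subr_gt0 // => d1.
  have [] := @IVT R g 0 1 (g 0 + 2^-1) ler01 cg.
    by rewrite min_l ?max_r //; [lra|exact: ltW|exact: ltW].
  move=> c; rewrite in_itv /= => /gZ cZ gc.
  have : 1 <= `|g c - g 0|.
    by apply: norm_intr_ge1; [exact: rpredB|rewrite gc addrC addKr invr_eq0].
  by rewrite gc addrC addKr ger0_norm; lra.
move=> cf fZ; have [f01|f01|->//] := ltgtP (f 0) (f 1).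
  by case: (main f).
case: (main (fun t => - f t)).
- by move=> t; apply: (@cvgN _ R^o); exact: cf.
- by move=> t /fZ ft; rewrite rpredN.
- by rewrite ltrN2.
Qed.

End continuity.

(** * Arguments of points of the circle, measured in turns *)

Section angles.
Context {R : realType}.
Implicit Types u v s t : R.

(** On the open right half-circle the arctangent of the slope is an argument, and it depends
    continuously on the point. *)
Lemma cos_sin_atan u v : 0 < u -> u ^+ 2 + v ^+ 2 = 1 ->
  cos (atan (v / u)) = u /\ sin (atan (v / u)) = v.
Proof.
move=> u0 uv1; have un0 : u != 0 by rewrite gt_eqF.
have cE : cos (atan (v / u)) = u.
  have -> : cos (atan (v / u)) = (Num.sqrt (u^-1 ^+ 2))^-1.
    rewrite cos_atan; congr (Num.sqrt _)^-1.
    have -> : 1 + (v / u) ^+ 2 = (u ^+ 2 + v ^+ 2) / u ^+ 2 by field.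
    by rewrite uv1 mul1r exprVn.
  by rewrite sqrtr_sqr ger0_norm ?invr_ge0 ?ltW // invrK.
split=> //; have := atanK (v / u); rewrite /tan cE => /(congr1 ( *%R^~ u)).
by rewrite /= !divfK.
Qed.

Lemma cos_sin_int t : t \is a Num.int ->
  cos (2 * pi * t) = 1 /\ sin (2 * pi * t) = 0.
Proof.
move=> /intrP[m ->].
have nat_case (n : nat) (s : R) : cos (s + 2 * pi * n%:R) = cos s /\
    sin (s + 2 * pi * n%:R) = sin s.
  have -> : 2 * pi * n%:R = (pi *+ 2) *+ n :> R.
    by rewrite mulr_natr mulr_natl.
  by rewrite (periodicn (@cosD2pi R)) (periodicn (@sinD2pi R)).
case: m => n.
  by have := nat_case n 0; rewrite add0r cos0 sin0.
(* [Negz n] stands for -(n + 1), so n + 1 further turns bring the angle back to 0. *)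
have := nat_case n.+1 (2 * pi * (Negz n)%:~R).
by rewrite -mulrDr NegzE mulrNz addNr mulr0 cos0 sin0 => -[<- <-].
Qed.

(** For the converse, let r = s - t and let z be its floor. Then cos (2 pi r) = 1, so the
    double-angle formula gives sin (pi (r - z)) = 0; as the sine is positive strictly between 0 and
    pi, r = z. *)
Lemma cos_sin_eq_mod1 s t : s - t \is a Num.int <->
  cos (2 * pi * s) = cos (2 * pi * t) /\ sin (2 * pi * s) = sin (2 * pi * t).
Proof.
split=> [stZ|[cE sE]].
  have [c1 s0] := cos_sin_int stZ.
  have -> : 2 * pi * s = 2 * pi * t + 2 * pi * (s - t) by ring.
  by rewrite cosD sinD c1 s0 !mulr1 !mulr0 subr0 addr0.
have : cos (2 * pi * (s - t)) = 1.
  by rewrite mulrBr cosB cE sE -!expr2 cos2Dsin2.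
set r := s - t; have /andP[fl fu] := floor_itv r.
set z := Num.floor r in fl fu.
have [c1 s0] := cos_sin_int (intr_int R z).
have -> : 2 * pi * r = pi * (r - z%:~R) *+ 2 + 2 * pi * z%:~R.
  by rewrite -[_ *+ 2]mulr_natl; ring.
rewrite cosD c1 s0 mulr1 mulr0 subr0 cos_mulr2n => c2.
have sn0 : sin (pi * (r - z%:~R)) = 0.
  have /eqP : sin (pi * (r - z%:~R)) ^+ 2 = 0 by rewrite sin2cos2; lra.
  by rewrite sqrf_eq0 => /eqP.
have [rz|rz] := eqVneq r z%:~R; first by rewrite rz intr_int.
have : 0 < sin (pi * (r - z%:~R)).
  have p0 := pi_gt0 R; rewrite intrD in fu.
  apply: sin_gt0_pi; rewrite pmulr_rgt0 // subr_gt0 lt_neqAle eq_sym rz fl /=.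
  by rewrite -[ltRHS]mulr1 ltr_pM2l //; lra.
by rewrite sn0 ltxx.
Qed.

End angles.

(** * Lifting along the covering of a torus *)

Ltac solve_continuous := repeat first
  [ match goal with
    | H : continuous ?f |- continuous ?f => exact: H
    | |- continuous (fun p => ?c) => exact: Defs.cst_cts
    | |- continuous (fun p => p) => exact: Defs.id_continuous
    | |- continuous (fun p => (@?f p, @?g p)) =>
        apply: (@Defs.pair_continuous _ _ _ f g)
    | |- continuous (fun p => @?f p * @?g p) =>
        apply: (@Defs.mul_continuous _ _ f g)
    | |- continuous (fun p => @?f p - @?g p) =>
        apply: (@Defs.sub_continuous _ _ f g)
    | |- continuous (fun p => @?f p + @?g p) =>
        apply: (@Defs.add_continuous _ _ f g)
    | |- continuous (fun p => (@?f p).1) =>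
        apply: (@Defs.comp_continuous _ _ _ f fst);
        last exact: Defs.fst_continuous
    | |- continuous (fun p => (@?f p).2) =>
        apply: (@Defs.comp_continuous _ _ _ f snd);
        last exact: Defs.snd_continuous
    | |- continuous (fun p => clamp (@?f p)) =>
        apply: (@Defs.comp_continuous _ _ _ f clamp);
        last exact: clamp_continuous
    | H : continuous ?h |- continuous (fun p => ?h (@?f p)) =>
        apply: (@Defs.comp_continuous _ _ _ f h); last exact: H
    end ].

Lemma continuous_comp_pair (R : realType) (T : topologicalType)
    (h : R * R -> R) (a b : T -> R) :
  continuous h -> continuous a -> continuous b ->
  continuous (fun t => h (a t, b t)).
Proof. by move=> ch ca cb; solve_continuous. Qed.

Lemma continuous_dot (R : realType) (T : topologicalType) (f g f' g' : T -> R) :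
  continuous f -> continuous g -> continuous f' -> continuous g' ->
  continuous (fun t => f t * g t + f' t * g' t).
Proof. by move=> cf cg cf' cg'; solve_continuous. Qed.

Section circle_lift.
Context {R : realType}.

(** The pair ([C], [S]) is a map from the plane to the unit circle, and [b] is the prescribed
    argument at the origin. Clamping makes [theta] continuous on the whole plane, while it is an
    argument of the map on the unit square. *)
Lemma circle_lift (C S : R * R -> R) (b : R) :
  continuous C -> continuous S -> (forall p, C p ^+ 2 + S p ^+ 2 = 1) ->
  C (0, 0) = cos (2 * pi * b) -> S (0, 0) = sin (2 * pi * b) ->
  exists theta : R * R -> R, [/\ continuous theta, theta (0, 0) = b &
    forall t s, 0 <= t <= 1 -> 0 <= s <= 1 ->
      C (t, s) = cos (2 * pi * theta (t, s)) /\
      S (t, s) = sin (2 * pi * theta (t, s))].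
Proof.
move=> cC cS CS1 C0 S0.
(* Here [x.1] is the end of the segment from the origin and [x.2] the parameter along it. The
   quantity is the cosine of the angle between the values at two successive parameters; it is 1 for
   step 0. *)
have [n nP] : exists n : nat, forall x : R * R * R,
    ((`[0, 1] `*` `[0, 1]) `*` `[0, 1]) x ->
    0 < C (x.2 * x.1.1, x.2 * x.1.2) *
        C ((x.2 + n.+1%:R^-1) * x.1.1, (x.2 + n.+1%:R^-1) * x.1.2) +
        S (x.2 * x.1.1, x.2 * x.1.2) *
        S ((x.2 + n.+1%:R^-1) * x.1.1, (x.2 + n.+1%:R^-1) * x.1.2).
  apply: (@compact_pos_invn R (R * R * R)%type ((`[0, 1] `*` `[0, 1]) `*` `[0, 1])
    (fun y => C (y.1.2 * y.1.1.1, y.1.2 * y.1.1.2) *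
       C ((y.1.2 + y.2) * y.1.1.1, (y.1.2 + y.2) * y.1.1.2) +
       S (y.1.2 * y.1.1.1, y.1.2 * y.1.1.2) *
       S ((y.1.2 + y.2) * y.1.1.1, (y.1.2 + y.2) * y.1.1.2))).
  - by do 2 ?apply: compact_setX; exact: segment_compact.
  - have cfst : continuous (fun y : R * R * R * R => y.1.1.1) by solve_continuous.
    have csnd : continuous (fun y : R * R * R * R => y.1.1.2) by solve_continuous.
    have ct : continuous (fun y : R * R * R * R => y.1.2) by solve_continuous.
    have cd : continuous (fun y : R * R * R * R => y.1.2 + y.2) by solve_continuous.
    have cCm (h : R * R -> R) (f : R * R * R * R -> R) : continuous h -> continuous f ->
        continuous (fun y => h (f y * y.1.1.1, f y * y.1.1.2)).
      move=> ch cf; apply: (@continuous_comp_pair R (R * R * R * R)%type h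
        (fun y => f y * y.1.1.1) (fun y => f y * y.1.1.2)) => //.
      + exact: Defs.mul_continuous.
      + exact: Defs.mul_continuous.
    by apply: continuous_dot; apply: cCm.
  - by move=> x _ /=; rewrite addr0 -!expr2 CS1 ltr01.
(* [pt k p] is the k-th division point of the segment from the origin to the clamped [p]; [u] and
   [v] are the cosine and sine of the angle from one value to the next. *)
pose pt (k : nat) (p : R * R) :=
  (k%:R / n.+1%:R * clamp p.1, k%:R / n.+1%:R * clamp p.2).
pose u k p := C (pt k p) * C (pt k.+1 p) + S (pt k p) * S (pt k.+1 p).
pose v k p := C (pt k p) * S (pt k.+1 p) - S (pt k p) * C (pt k.+1 p).
have u_gt0 k p : (k < n.+1)%N -> 0 < u k p.
  move=> kn; have := nP (clamp p.1, clamp p.2, k%:R / n.+1%:R).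
  have -> : k%:R / n.+1%:R + n.+1%:R^-1 = k.+1%:R / n.+1%:R :> R.
    by rewrite -[k.+1%:R]natr1 mulrDl mul1r.
  apply; split; first by split; exact: clamp_itv.
  rewrite /= in_itv /= divr_ge0 // ler_pdivrMr ?ltr0Sn // mul1r ler_nat.
  exact: ltnW.
pose theta j p := b + \sum_(k < j) atan (v k p / u k p) / (2 * pi).
have pi2_neq0 : 2 * pi != 0 :> R by rewrite mulf_neq0 ?pnatr_eq0 // gt_eqF ?pi_gt0.
have thetaP p j : (j <= n.+1)%N ->
    C (pt j p) = cos (2 * pi * theta j p) /\
    S (pt j p) = sin (2 * pi * theta j p).
  elim: j => [|j IH] jn.
    by rewrite /pt /theta !mul0r big_ord0 addr0.
  have [Cj Sj] := IH (ltnW jn).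
  have -> : 2 * pi * theta j.+1 p = 2 * pi * theta j p + atan (v j p / u j p).
    by rewrite /theta big_ord_recr /= addrA mulrDr mulrCA mulfV // mulr1.
  (* The sum of the squares of [u] and [v] is 1 because it is the product of two sums of squares,
     each equal to 1. *)
  have [] := @cos_sin_atan R (u j p) (v j p) (u_gt0 j p jn).
    rewrite -[RHS]mulr1 -{1}(CS1 (pt j p)) -(CS1 (pt j.+1 p)) /u /v; ring.
  move=> cu sv; rewrite cosD sinD -Cj -Sj cu sv /u /v.
  by split; rewrite -[LHS]mul1r -(CS1 (pt j p)); ring.
exists (theta n.+1); split.
- apply: Defs.add_continuous; first exact: Defs.cst_cts.
  apply: (@continuous_sum R (R * R)%type _ (index_enum 'I_n.+1)
    (fun k p => atan (v k p / u k p) / (2 * pi))) => k.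
  have cpt j : continuous (pt j).
    by rewrite /pt; solve_continuous.
  have cCp j : continuous (fun p => C (pt j p)).
    exact: (@Defs.comp_continuous _ _ _ (pt j) C).
  have cSp j : continuous (fun p => S (pt j p)).
    exact: (@Defs.comp_continuous _ _ _ (pt j) S).
  have cu : continuous (u k) by rewrite /u; solve_continuous.
  have cv : continuous (v k) by rewrite /v; solve_continuous.
  apply: Defs.mul_continuous; last exact: Defs.cst_cts.
  apply: (@Defs.comp_continuous _ _ _ (fun p => v k p / u k p) atan); last first.
    by move=> y; exact: continuous_atan.
  apply: Defs.mul_continuous => // p.
  by apply: continuousV; [rewrite gt_eqF ?u_gt0|exact: cu].
(* Over the origin all division points coincide, so every angle increment vanishes. *)
- rewrite /theta big1 ?addr0 // => k _.
  have clamp0 : clamp 0 = 0 :> R by rewrite clamp_id // lexx ler01.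
  by rewrite /v /pt /= clamp0 !mulr0 [C _ * _]mulrC subrr mul0r atan0 mul0r.
- move=> t s t01 s01; have := thetaP (t, s) n.+1 (leqnn _).
  by rewrite /pt /= divff ?pnatr_eq0 // !mul1r !clamp_id.
Qed.

End circle_lift.

Section torus_lift.
Context {R : realType} {X : topologicalType} {n : nat}.
Context {q : 'rV[R]_n -> X}.
Hypotheses (hX : hausdorff_space X) (cq : continuous q)
  (q_surj : forall x, exists e, q e = x)
  (qP : forall e e', q e = q e' <-> forall i, e 0 i - e' 0 i \is a Num.int).

(** Fractional parts of the coordinates give the section. It need not be continuous; what matters is
    that its values lie in a compact box. *)
Lemma unit_box_section :
  exists s : X -> 'rV[R]_n, cancel s q /\ forall x i, 0 <= s x 0 i <= 1.
Proof.
have ex x : exists e : 'rV[R]_n, q e = x /\ forall i, 0 <= e 0 i <= 1.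
  have [e <-] := q_surj x.
  exists (\row_i (e 0 i - (Num.floor (e 0 i))%:~R)); split=> [|i].
    apply/qP => i; rewrite mxE addrAC subrr add0r rpredN.
    exact: intr_int.
  have := floor_itv (e 0 i); rewrite mxE intrD; lra.
have [s sP] := boolp.choice ex.
by exists s; split=> [x|x i]; have [] := sP x.
Qed.

(* [q] maps closed subsets of the unit box to closed sets, so it is a
   quotient map. *)
Lemma descend_continuous (phi : 'rV[R]_n -> R) (s : X -> 'rV[R]_n) :
  continuous phi -> (forall e e', q e = q e' -> phi e = phi e') ->
  cancel s q -> (forall x i, 0 <= s x 0 i <= 1) -> continuous (phi \o s).
Proof.
move=> cphi phiq sK s01; apply/continuous_closedP => A cA.
pose box : set 'rV[R]_n := [set e | forall i, (`[0, 1]%classic : set R) (e ord0 i)].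
have -> : (phi \o s) @^-1` A = q @` (box `&` phi @^-1` A).
  apply/seteqP; split=> [x /= Ax|_ [e [_ /= Ae] <-]] /=.
    by exists (s x); [split=> // i; rewrite /= in_itv /= s01|exact: sK].
  have -> // : phi (s (q e)) = phi e by apply: phiq; rewrite sK.
apply: (compact_closed hX); apply: continuous_compact.
  exact: continuous_subspaceT.
apply: compact_closedI; last by move/continuous_closedP : cphi; exact.
by apply: (@rV_compact R n (fun=> `[0, 1]%classic)) => i; exact: segment_compact.
Qed.

(** The cosine and sine of each coordinate are periodic, so they descend to continuous functions on
    [X]. Composed with [H] they give one circle-valued map per coordinate, and each is lifted
    separately. *)
Lemma torus_lift (H : R * R -> X) (e : 'rV[R]_n) :
  continuous H -> H (0, 0) = q e ->
  exists theta : R * R -> 'rV[R]_n, [/\ continuous theta, theta (0, 0) = e &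
    forall t s, 0 <= t <= 1 -> 0 <= s <= 1 -> q (theta (t, s)) = H (t, s)].
Proof.
move=> cH H0; have [s [sK s01]] := unit_box_section.
have c2 i : continuous (fun e : 'rV[R]_n => 2 * pi * e 0 i).
  by apply: Defs.mul_continuous; [exact: Defs.cst_cts|exact: coord_continuous].
pose C i e := cos (2 * pi * (e : 'rV[R]_n) 0 i).
pose S i e := sin (2 * pi * (e : 'rV[R]_n) 0 i).
have cC i : continuous (C i).
  by apply: (Defs.comp_continuous (c2 i)); exact: continuous_cos.
have cS i : continuous (S i).
  by apply: (Defs.comp_continuous (c2 i)); exact: continuous_sin.
(* These functions also separate the points of [X], so that agreement in all of them shows that the
   lift projects to [H]. *)
have qCS f g : q f = q g <-> forall i, C i f = C i g /\ S i f = S i g.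
  by split=> [/qP fg i|fg]; [exact/cos_sin_eq_mod1|
    apply/qP => i; apply/cos_sin_eq_mod1; exact: fg].
have lift i : exists theta : R * R -> R, [/\ continuous theta,
    theta (0, 0) = e 0 i &
    forall t t', 0 <= t <= 1 -> 0 <= t' <= 1 ->
      C i (s (H (t, t'))) = cos (2 * pi * theta (t, t')) /\
      S i (s (H (t, t'))) = sin (2 * pi * theta (t, t'))].
  have H0E : q (s (H (0, 0))) = q e by rewrite sK.
  apply: (@circle_lift R (C i \o s \o H) (S i \o s \o H)).
  - apply: (Defs.comp_continuous cH); apply: descend_continuous => // f g.
    by move=> /qCS/(_ i)[].
  - apply: (Defs.comp_continuous cH); apply: descend_continuous => // f g.
    by move=> /qCS/(_ i)[].
  - by move=> p; exact: cos2Dsin2.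
  - by have [] := (qCS _ _).1 H0E i.
  - by have [] := (qCS _ _).1 H0E i.
have [th thP] := boolp.choice lift.
exists (fun p => \row_i th i p); split.
- apply: continuous_row => i; under eq_fun do rewrite mxE.
  by have [] := thP i.
- by apply/rowP => i; rewrite mxE; have [] := thP i.
- move=> t t' t01 t'01; rewrite -[RHS]sK; apply/qCS => i.
  have [_ _ /(_ t t' t01 t'01)[Ci Si]] := thP i.
  by rewrite Ci Si /C /S mxE.
Qed.

End torus_lift.

(** * The fundamental group of a torus *)

Section torus_pi1.
Context {R : realType} {X : topologicalType} {n : nat}.
Context {q : 'rV[R]_n -> X}.
Hypotheses (hX : hausdorff_space X) (cq : continuous q)
  (q_surj : forall x, exists e, q e = x)
  (qP : forall e e', q e = q e' <-> forall i, e 0 i - e' 0 i \is a Num.int).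
Variable e0 : 'rV[R]_n.

(** Each coordinate of the difference of two lifts of one path is continuous with integer values,
    hence takes the same value at both ends. *)
Lemma lifts_same_displacement (T T' : R -> 'rV[R]_n) :
  continuous T -> continuous T' ->
  (forall t, 0 <= t <= 1 -> q (T t) = q (T' t)) -> T 1 - T 0 = T' 1 - T' 0.
Proof.
move=> cT cT' TT'; apply/rowP => i; rewrite !mxE.
have cc (f : R -> 'rV[R]_n) : continuous f -> continuous (fun t => f t 0 i).
  move=> cf; apply: (@Defs.comp_continuous _ _ _ f (fun e => e 0 i)) => //.
  exact: coord_continuous.
suff : T 1 0 i - T' 1 0 i = T 0 0 i - T' 0 0 i by lra.
apply: (@int_valued_const R (fun t => T t 0 i - T' t 0 i)).
  apply: continuous_subspaceT.
  by apply: Defs.sub_continuous; exact: cc.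
by move=> t /TT'/qP.
Qed.

(** As R^n is convex, the lifts are joined by the affine homotopy, which fixes their common ends and
    is then projected by [q]. *)
Lemma straight_line_homotopic (T T' : R -> 'rV[R]_n) (a b : loop R (q e0)) :
  continuous T -> continuous T' -> T 0 = T' 0 -> T 1 = T' 1 ->
  (forall t, 0 <= t <= 1 -> a t = q (T t)) ->
  (forall t, 0 <= t <= 1 -> b t = q (T' t)) -> loop_homotopic a b.
Proof.
move=> cT cT' T0 T1 aT bT'.
exists (fun p => q (\row_i ((1 - p.2) * T p.1 0 i + p.2 * T' p.1 0 i))); split.
- apply: continuous_subspaceT.
  apply: (@Defs.comp_continuous _ _ _ _ q) => //.
  apply: continuous_row => i; under eq_fun do rewrite mxE.
  have cc (f : R -> 'rV[R]_n) :
      continuous f -> continuous (fun p : R * R => f p.1 0 i).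
    move=> cf; apply: (@Defs.comp_continuous _ _ _ (fun p : R * R => f p.1)
      (fun e => e 0 i)); last exact: coord_continuous.
    by apply: (@Defs.comp_continuous _ _ _ fst f) => //; exact: Defs.fst_continuous.
  have c2 : continuous (fun p : R * R => p.2) by exact: Defs.snd_continuous.
  have c1 : continuous (fun p : R * R => 1 - p.2).
    by apply: Defs.sub_continuous => //; exact: Defs.cst_cts.
  by apply: Defs.add_continuous; apply: Defs.mul_continuous => //; exact: cc.
- move=> t t01; rewrite aT //=; congr q; apply/rowP => i.
  by rewrite mxE; ring.
- move=> t t01; rewrite bT' //=; congr q; apply/rowP => i.
  by rewrite mxE; ring.
- have i0 : 0 <= (0 : R) <= 1 by rewrite lexx ler01.
  have i1 : 0 <= (1 : R) <= 1 by rewrite lexx ler01.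
  have ends (e e' : 'rV[R]_n) (s : R) : e = e' ->
      \row_i ((1 - s) * e 0 i + s * e' 0 i) = e.
    by move=> <-; apply/rowP => i; rewrite mxE; ring.
  move=> s _ /=; rewrite !ends //.
  by rewrite -(aT 0 i0) -(aT 1 i1) loop0 loop1.
Qed.

Definition line_map (m : 'rV[int]_n) (t : R) : 'rV[R]_n :=
  e0 + t *: map_mx intr m.

Lemma line_map_continuous m : continuous (line_map m).
Proof.
apply: continuous_row => i; rewrite /line_map; under eq_fun do rewrite !mxE.
apply: Defs.add_continuous; first exact: Defs.cst_cts.
apply: Defs.mul_continuous; [exact: Defs.id_continuous|exact: Defs.cst_cts].
Qed.

Lemma line_map0 m : line_map m 0 = e0.
Proof. by rewrite /line_map scale0r addr0. Qed.

Lemma line_map1 m : line_map m 1 = e0 + map_mx intr m.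
Proof. by rewrite /line_map scale1r. Qed.

Lemma q_addz e (m : 'rV[int]_n) : q (e + map_mx intr m) = q e.
Proof. by apply/qP => i; rewrite !mxE addrAC subrr add0r intr_int. Qed.

Lemma line_continuous m : {within `[0, 1], continuous (q \o line_map m)}.
Proof.
apply: continuous_subspaceT; apply: Defs.comp_continuous => //.
exact: line_map_continuous.
Qed.

Lemma line0 m : (q \o line_map m) 0 = q e0.
Proof. by rewrite /= line_map0. Qed.

Lemma line1 m : (q \o line_map m) 1 = q e0.
Proof. by rewrite /= line_map1 q_addz. Qed.

Definition line m : loop R (q e0) :=
  Loop (@line_continuous m) (line0 m) (line1 m).

Lemma line_catD m k : loop_homotopic (line (m + k)) (loop_cat (line m) (line k)).
Proof.
(* A lift of the concatenation: the second half is translated by [m] to start where the first one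
   ends, so [T] has the same ends as the straight path of [m + k]. *)
pose T t := if t <= 2^-1 then line_map m (2 * t)
  else map_mx intr m + line_map k (2 * t - 1).
have c2 : continuous (fun t : R => 2 * t).
  by apply: Defs.mul_continuous; [exact: Defs.cst_cts|exact: Defs.id_continuous].
have cT : continuous T.
  apply: (@Defs.continuous_glue _ _ _ id).
  - exact: Defs.id_continuous.
  - apply: (@Defs.comp_continuous _ _ _ (fun t : R => 2 * t)) => //.
    exact: line_map_continuous.
  - apply: continuous_row => i; under eq_fun do rewrite mxE.
    apply: Defs.add_continuous; first exact: Defs.cst_cts.
    apply: (@Defs.comp_continuous _ _ _ (fun t : R => line_map k (2 * t - 1))
      (fun e => e 0 i)); last exact: coord_continuous.
    apply: (@Defs.comp_continuous _ _ _ (fun t : R => 2 * t - 1)).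
      by apply: Defs.sub_continuous => //; exact: Defs.cst_cts.
    exact: line_map_continuous.
  - by move=> t ->; rewrite divff // subrr line_map1 line_map0 addrC.
apply: (@straight_line_homotopic (line_map (m + k)) T) => //.
- exact: line_map_continuous.
- by rewrite /T invr_ge0 ler0n mulr0 !line_map0.
- rewrite /T ifF; last by apply/negbTE; rewrite -ltNge; lra.
  have -> : 2 * 1 - 1 = 1 :> R by lra.
  by rewrite !line_map1 map_mxD addrCA addrA.
- move=> t t01 /=; rewrite /cat_fun /T; case: ifP => // _ /=.
  by rewrite [map_mx _ _ + _]addrC q_addz.
Qed.

(** Lift the homotopy to the square. The two horizontal edges are displaced by [m] and [k], and the
    vertical edges, which lie over the base point, by 0; comparing the two ways round gives
    [m = k]. *)
Lemma line_inj m k : loop_homotopic (line m) (line k) -> m = k.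
Proof.
move=> [H [cH H0 H1 Hx]].
have i0 : 0 <= (0 : R) <= 1 by rewrite lexx ler01.
have i1 : 0 <= (1 : R) <= 1 by rewrite lexx ler01.
have [|theta [cth th0 thH]] := torus_lift hX cq q_surj qP
    (e := e0) (homotopy_clamp_continuous cH).
  by rewrite /= clamp_id // H0 // [LHS]line0.
have qth t s : 0 <= t <= 1 -> 0 <= s <= 1 -> q (theta (t, s)) = H (t, s).
  by move=> t01 s01; rewrite thH //= !clamp_id.
have cth1 s : continuous (fun t => theta (t, s)).
  apply: (@Defs.comp_continuous _ _ _ (fun t : R => (t, s)) theta) => //.
  by apply: Defs.pair_continuous; [exact: Defs.id_continuous|exact: Defs.cst_cts].
have cth2 t : continuous (fun s => theta (t, s)).
  apply: (@Defs.comp_continuous _ _ _ (fun s : R => (t, s)) theta) => //.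
  by apply: Defs.pair_continuous; [exact: Defs.cst_cts|exact: Defs.id_continuous].
have ccst : continuous (fun _ : R => e0) by exact: Defs.cst_cts.
have := lifts_same_displacement (cth1 0) (@line_map_continuous m).
rewrite line_map0 line_map1 th0 => E0.
have {}E0 := E0 (fun t t01 => etrans (qth _ _ t01 i0) (H0 t t01)).
have := lifts_same_displacement (cth1 1) (@line_map_continuous k).
rewrite line_map0 line_map1 => E1.
have {}E1 := E1 (fun t t01 => etrans (qth _ _ t01 i1) (H1 t t01)).
have := lifts_same_displacement (cth2 0) ccst.
move=> /(_ (fun s s01 => etrans (qth _ _ i0 s01) (Hx s s01).1)) E2.
have := lifts_same_displacement (cth2 1) ccst.
move=> /(_ (fun s s01 => etrans (qth _ _ i1 s01) (Hx s s01).2)) E3.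
move: E0 E1 E2 E3 => /rowP E0 /rowP E1 /rowP E2 /rowP E3.
apply/rowP => i; apply: (@intr_inj R).
by move: (E0 i) (E1 i) (E2 i) (E3 i); rewrite th0 !mxE; lra.
Qed.

(** A lift of [g] ends at an integral translate of [e0], and it is homotopic to the straight path
    with the same ends. *)
Lemma line_surj (g : loop R (q e0)) : exists m, loop_homotopic (line m) g.
Proof.
have i0 : 0 <= (0 : R) <= 1 by rewrite lexx ler01.
have i1 : 0 <= (1 : R) <= 1 by rewrite lexx ler01.
(* Lifting is available for maps of two variables, so the loop is extended constantly in the second
   one. *)
have cH : continuous (fun p : R * R => (g \o clamp) p.1).
  apply: (@Defs.comp_continuous _ _ _ fst (g \o clamp)).
    exact: Defs.fst_continuous.
  exact: loop_clamp_continuous.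
have [|theta [cth th0 thH]] := torus_lift hX cq q_surj qP (e := e0) cH.
  by rewrite /= clamp_id // loop0.
have qth t : 0 <= t <= 1 -> q (theta (t, 0)) = g t.
  by move=> t01; rewrite thH //= clamp_id.
have /qP th1 : q (theta (1, 0)) = q e0 by rewrite qth // loop1.
pose m : 'rV[int]_n := \row_i Num.floor (theta (1, 0) 0 i - e0 0 i).
exists m.
apply: (@straight_line_homotopic (line_map m) (fun t => theta (t, 0))).
- exact: line_map_continuous.
- apply: (@Defs.comp_continuous _ _ _ (fun t : R => (t, 0)) theta) => //.
  by apply: Defs.pair_continuous; [exact: Defs.id_continuous|exact: Defs.cst_cts].
- by rewrite line_map0 th0.
- rewrite line_map1; apply/rowP => i; rewrite !mxE.
  have := th1 i; rewrite intrEfloor => /eqP ->.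
  by rewrite addrC subrK.
- by [].
- by move=> t /qth.
Qed.

Lemma pi1_torus : iso_onto (fun m => pi1_class (line m)) [set: pi1 R (q e0)].
Proof.
split.
- by move=> m k; rewrite [RHS]pi1_mulE; apply/pi1_classP; exact: line_catD.
- by move=> m k /pi1_classP; exact: line_inj.
- apply/seteqP; split=> // u _; rewrite -(pi1_class_repr u).
  by have [m mg] := line_surj (repr u); exists m => //; apply/pi1_classP.
Qed.

End torus_pi1.

(** * The boundary of the exterior *)

(** An additive map is right multiplication by the matrix [A] of the images of the unit vectors.
    Preimages of the unit vectors form a matrix [B] with [B *m A = 1], whence [A *m B = 1] and [f]
    can be undone. *)
Lemma additive_surj_inj (n : nat) (f : 'rV[int]_n -> 'rV[int]_n) :
  {morph f : u v / u + v} -> (forall v, exists u, f u = v) -> injective f.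
Proof.
move=> fD fsurj.
have f0 : f 0 = 0 by apply: (addrI (f 0)); rewrite -fD !addr0.
have fN u : f (- u) = - f u by apply: (addrI (f u)); rewrite -fD !subrr.
have fnat u k : f (u *+ k) = f u *+ k.
  by elim: k => [|k IH]; rewrite ?mulr0n // !mulrS fD IH.
have fZ (z : int) u : f (z *: u) = z *: f u.
  rewrite -[z]intz !scaler_int.
  by case: z => k; rewrite ?NegzE ?mulrNz -!pmulrn ?fN fnat.
have fsum (I : Type) (r : seq I) (F : I -> 'rV_n) :
    f (\sum_(i <- r) F i) = \sum_(i <- r) f (F i).
  by elim: r => [|i r IH]; rewrite ?big_nil // !big_cons fD IH.
pose A := \matrix_i f (delta_mx 0 i).
have fE u : f u = u *m A.
  rewrite mulmx_sum_row {1}(row_sum_delta u) fsum.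
  by apply: eq_bigr => i _; rewrite fZ rowK.
have [g gP] := boolp.choice fsurj.
pose B := \matrix_i g (delta_mx 0 i).
have BA : B *m A = 1%:M.
  by apply/row_matrixP => i; rewrite row_mul rowK -fE gP row1.
have AB := mulmx1C BA.
by move=> u v; rewrite !fE => uv; rewrite -[u]mulmx1 -[v]mulmx1 -AB !mulmxA uv.
Qed.

(** The pairs are nested as in [int * tau] with [tau] equal to [int * int]. *)
Definition rV3_of_int3 (z : int * (int * int)) : 'rV[int]_3 :=
  \row_i [:: z.1; z.2.1; z.2.2]`_i.

Definition int3_of_rV3 (v : 'rV[int]_3) : int * (int * int) :=
  (v 0 0, (v 0 1, v 0 2)).

Lemma rV3_of_int3K : cancel rV3_of_int3 int3_of_rV3.
Proof. by move=> [a [b c]]; rewrite /int3_of_rV3 !mxE. Qed.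

Lemma int3_of_rV3K : cancel int3_of_rV3 rV3_of_int3.
Proof.
move=> v; apply/rowP => i; rewrite mxE /=.
by case: i => -[|[|[|//]]] ilt /=; congr (v _ _); apply: val_inj.
Qed.

Lemma rV3_of_int3D : {morph rV3_of_int3 : z w / z + w}.
Proof.
by move=> [a [b c]] [a' [b' c']]; apply/rowP => -[[|[|[|//]]] ilt]; rewrite !mxE.
Qed.

(** The arccosine of the first coordinate has the right cosine and the right sine up to sign;
    negating the angle corrects the sign. *)
Lemma circle_point_surj (R : realType) (v : 'rV[R]_2) :
  circle v -> exists b, circle_point b = v.
Proof.
rewrite /circle /sqnorm /= big_ord_recl big_ord1 /= => v1.
set c := v 0 0 in v1; set s := v 0 _ in v1.
have c1 : -1 <= c <= 1 by nra.
have sinE : sin (acos c) = `|s|.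
  by rewrite sin_acos // -v1 addrAC subrr add0r sqrtr_sqr.
have pi2_neq0 : 2 * pi != 0 :> R by rewrite mulf_neq0 ?pnatr_eq0 // gt_eqF ?pi_gt0.
suff [b [cb sb]] : exists b, cos b = c /\ sin b = s.
  exists (b / (2 * pi)); apply/rowP => i; rewrite mxE mulrC divfK // cb sb.
  by case: i => -[|[|//]] ilt /=; congr (v _ _); apply: val_inj.
have [s0|s0] := leP 0 s.
  by exists (acos c); rewrite acosK // sinE ger0_norm.
by exists (- acos c); rewrite cosN sinN acosK // sinE ltr0_norm // opprK.
Qed.

Section boundary_torus.
Context {R : realType} {F : smooth_torus R} (nu : tubular F).

Lemma boundary_hausdorff : hausdorff_space (set_type (boundary nu)).
Proof.
move=> p r pr; apply: val_inj; apply: norm_hausdorff => A B nA nB.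
have cval := @initial_continuous (set_type (boundary nu)) _ set_val.
have [y [Ay By]] := pr _ _ (cval p _ nA) (cval r _ nB).
by exists (set_val y).
Qed.

(** The universal covering of the 3-torus: two coordinates for the surface and one for the meridian
    angle in turns. *)
Definition boundary_cover (e : 'rV[R]_(2 + 1)) : set_type (boundary nu) :=
  boundary_point nu (lsubmx e) (rsubmx e 0 0).

Lemma boundary_cover_continuous : continuous boundary_cover.
Proof.
apply: (@continuous_comp_initial _ _ _ set_val boundary_cover) => e.
have ce : continuous (fun e : 'rV[R]_(2 + 1) =>
    (lsubmx e, circle_point (rsubmx e 0 0))).
  apply: Defs.pair_continuous.
    apply: continuous_row => i; under eq_fun do rewrite mxE.
    exact: coord_continuous.
  apply: (@Defs.comp_continuous _ _ _ (fun e : 'rV[R]_(2 + 1) => rsubmx e 0 0)).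
    by under eq_fun do rewrite mxE; exact: coord_continuous.
  exact: circle_point_continuous.
(* The case k = 0 of smoothness is continuity at the points of a neighbourhood of the closed
   tube. *)
have [U [_ AU /(_ 0%N) /= cU]] := tub_smooth nu.
apply: (@continuous_comp _ _ _ (fun e : 'rV[R]_(2 + 1) =>
    (lsubmx e, circle_point (rsubmx e 0 0))) nu); first exact: ce.
apply: cU; apply: AU; split=> //=.
by have := circle_pointP (rsubmx e 0 0); rewrite /circle /disk /= => ->.
Qed.

Lemma boundary_cover_row x a :
  boundary_cover (row_mx x a%:M) = boundary_point nu x a.
Proof. by rewrite /boundary_cover row_mxKl row_mxKr mxE. Qed.

Lemma boundary_cover_surj p : exists e, boundary_cover e = p.
Proof.
have [[x v] [_ /= /circle_point_surj[a <-]] xvp] := set_valP p.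
by exists (row_mx x a%:M); rewrite boundary_cover_row; apply: val_inj.
Qed.

Lemma boundary_coverP e e' : boundary_cover e = boundary_cover e' <->
  forall i, e 0 i - e' 0 i \is a Num.int.
Proof.
have d b : disk (circle_point b : 'rV[R]_2).
  by have := circle_pointP b; rewrite /circle /disk /= => ->.
have inj := tub_inj nu (lsubmx e) (lsubmx e') (d (rsubmx e 0 0))
  (d (rsubmx e' 0 0)).
have cP b c : circle_point b = circle_point c :> 'rV[R]_2 <->
    b - c \is a Num.int.
  split=> [/rowP bc|/cos_sin_eq_mod1 [cE sE]].
    by apply/cos_sin_eq_mod1; move: (bc 0) (bc 1); rewrite !mxE.
  by apply/rowP => i; rewrite !mxE cE sE.
split=> [/(congr1 set_val)/inj[le /cP re] i|eZ].
  rewrite -[e]hsubmxK -[e']hsubmxK.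
  case: (split_ordP i) => j ->; first by rewrite !row_mxEl; exact: le.
  by rewrite !row_mxEr ord1.
apply/val_inj/inj; split; first by move=> i; rewrite !mxE.
by apply/cP; rewrite !mxE.
Qed.

Lemma pi1_boundary x a :
  exists h : 'rV[int]_3 -> pi1 R (boundary_point nu x a),
    iso_onto h [set: pi1 R (boundary_point nu x a)].
Proof.
(* The base point has to be displayed as the image of a point of R^3. *)
rewrite -boundary_cover_row; eexists.
exact: (pi1_torus boundary_hausdorff boundary_cover_continuous
  boundary_cover_surj boundary_coverP).
Qed.

End boundary_torus.

Theorem proposition5p1 (R : realType) (F : smooth_torus R) (nu : tubular F)
    (x : 'rV[R]_2) (a : R) :
  has_type nu x a (int * int)%type ->
  [/\ (exists h : int * int * int -> pi1 R (boundary_point nu x a),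
         iso_onto h [set: pi1 R (boundary_point nu x a)]),
      injective (boundary_hom nu x a) &
      forall g : loop R (boundary_point nu x a),
        primitive (pi1_class g) -> pi1_class g <> 1%g ->
        ~ null_homotopic (loop_map (boundary_incl nu) g)].
Proof.
move=> [h [hD h_inj h_im] _].
have [k [kD k_inj k_im]] := pi1_boundary nu x a.
have k_surj u : exists m, k m = u.
  by have : [set: _] u by []; rewrite -k_im => -[m _ <-]; exists m.
have bh_inj : injective (boundary_hom nu x a).
  (* [f] is the boundary homomorphism read as an endomorphism of Z^3, through [k] on the source and
     [h] on the peripheral subgroup. *)
  have [f fP] : {f | forall m, h (int3_of_rV3 (f m)) = boundary_hom nu x a (k m)}.
    suff /boolp.choice[f fP] : forall m, exists z, h z = boundary_hom nu x a (k m).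
      by exists (fun m => rV3_of_int3 (f m)) => m; rewrite rV3_of_int3K.
    move=> m; have [z _ <-] : range h (boundary_hom nu x a (k m)).
      by rewrite h_im; exists (k m).
    by exists z.
  have f_inj : injective f.
    apply: additive_surj_inj => [m m'|v].
      apply: (can_inj int3_of_rV3K); apply: h_inj.
      rewrite -[f m]int3_of_rV3K -[f m']int3_of_rV3K -rV3_of_int3D.
      by rewrite rV3_of_int3K fP kD gmulfM hD !fP.
    (* [f] is surjective because every value of [h] lies in the peripheral subgroup, the image of
       the boundary homomorphism. *)
    have [u _ uv] : range (boundary_hom nu x a) (h (int3_of_rV3 v)).
      by have : range h (h (int3_of_rV3 v)) by []; rewrite h_im.
    have [m mu] := k_surj u; exists m.
    by apply: (can_inj int3_of_rV3K); apply: h_inj; rewrite fP mu.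
  move=> u v; have [m <-] := k_surj u; have [m' <-] := k_surj v.
  by rewrite -!fP => /h_inj/(can_inj int3_of_rV3K)/f_inj ->.
split=> //.
- exists (fun z => k (rV3_of_int3 (z.1.1, (z.1.2, z.2)))); split.
  + by move=> z w; rewrite -kD -rV3_of_int3D.
  + by move=> [[? ?] ?] [[? ?] ?] /k_inj/(can_inj rV3_of_int3K)[-> -> ->].
  + apply/seteqP; split=> // u _; have [m <-] := k_surj u.
    case mE : (int3_of_rV3 m) => [b [c d]].
    by exists (b, c, d) => //=; rewrite -mE int3_of_rV3K.
(* A null-homotopy makes the image of the class of [g] trivial, so by injectivity the class itself
   is trivial, against [g1]. *)
- move=> g _ g1 /pi1_classP; rewrite -pi1_mapE => gn.
  apply/g1/bh_inj; apply: etrans (gn : _ = 1%g) _.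
  by apply: (mulgI (boundary_hom nu x a 1%g)); rewrite -gmulfM !mulg1.
Qed.
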